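(* Let $t\in\mathbb Z$. For $\mathbf b=(b_k)_{k\in\mathbb Z}\in\widehat B_{\mathfrak g}(\infty)$ let $\mathrm D^t(\mathbf b)\in\widehat B_{\mathfrak g}(\infty)$ be the element whose $k$-th component is $b_{k-t}$ for every $k\in\mathbb Z$. Then $\mathrm D^t:\widehat B_{\mathfrak g}(\infty)\to\widehat B_{\mathfrak g}(\infty)$ is a bijection such that, for all $(i,k)\in\widehat I=I\times\mathbb Z$ and all $\mathbf b$, $$\mathrm D^t(\widetilde F_{i,k}(\mathbf b))=\widetilde F_{i,k+t}(\mathrm D^t(\mathbf b))\quad\text{and}\quad\mathrm D^t(\widetilde F^*_{i,k}(\mathbf b))=\widetilde F^*_{i,k+t}(\mathrm D^t(\mathbf b)).$$
   Context: $\mathfrak g$ is the Kac-Moody algebra associated with a symmetrizable generalized Cartan matrix with index set $I$. $B(\infty)$ is the crystal of $U_q^-(\mathfrak g)$ with highest element $\mathsf 1$, operators $\tilde e_i,\tilde f_i$ and functions $\varepsilon_i$. The antiautomorphism $*$ of $U_q(\mathfrak g)$ with $e_i^*=e_i$, $f_i^*=f_i$, $(q^h)^*=q^{-h}$ induces an involution $*$ of $B(\infty)$; $\tilde e_i^*=*\circ\tilde e_i\circ*$, $\tilde f_i^*=*\circ\tilde f_i\circ*$, $\varepsilon_i^*(b)=\varepsilon_i( *b)$. The extended crystal is $\widehat B_{\mathfrak g}(\infty)=\{(b_k)_{k\in\mathbb Z}\in\prod_{k\in\mathbb Z}B(\infty)\mid b_k=\mathsf 1\text{ for all but finitely many }k\}$.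 For $\mathbf b=(b_k)_k$ put $\widehat\varepsilon_{i,k}(\mathbf b)=\varepsilon_i(b_k)-\varepsilon_i^*(b_{k+1})$. $\widetilde F_{i,k}(\mathbf b)$ is obtained from $\mathbf b$ by replacing $b_k$ by $\tilde f_i(b_k)$ if $\widehat\varepsilon_{i,k}(\mathbf b)\ge0$, and by replacing $b_{k+1}$ by $\tilde e_i^*(b_{k+1})$ if $\widehat\varepsilon_{i,k}(\mathbf b)<0$. The involution $\star$ of $\widehat B_{\mathfrak g}(\infty)$ sends $(b_k)_k$ to $( *(b_{-k}))_k$, and $\widetilde F^*_{i,k}(\mathbf b)=\star(\widetilde F_{i,-k}(\star(\mathbf b)))$. *)

(* Defs.v *)
From HB Require Import structures.
From mathcomp Require Import all_boot all_order all_algebra.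
From mathcomp Require Import generic_quotient ring_quotient fraction.
From mathcomp Require Import boolp classical_sets cardinality.
From mathcomp.multinomials Require Import monalg.

Set Implicit Arguments.
Unset Strict Implicit.
Unset Printing Implicit Defensive.

Import Order.TTheory GRing.Theory Num.Theory.
Local Open Scope classical_set_scope.
Local Open Scope ring_scope.

Lemma lalg_scalerAr (K : comNzRingType) (L : lalgType K) (k : K) (x y : L) :
  (forall z : L, k%:A * z = z * k%:A) -> k *: (x * y) = x * (k *: y).
Proof.
by move=> H; rewrite -[k *: (x * y)]mulr_algl mulrA H -mulrA mulr_algl.
Qed.

Section FreeAlgebra.
Context (K : comNzRingType) (G : choiceType).

(* [malg] only has an [algType] instance over commutative monomials, hence    *)
(* this alias.                                                                *)
Definition falg : Type := {malg K[{fmonom G}]}.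
HB.instance Definition _ := GRing.Lalgebra.on falg.
Definition fgen (x : G) : falg := << fmu x >>.

Lemma malgC_comm (k : K) (x : {malg K[{fmonom G}]}) : k%:MP * x = x * k%:MP.
Proof.
rewrite [in LHS](monalgE x) [in RHS](monalgE x) mulr_sumr mulr_suml.
by apply: eq_bigr => m _; rewrite !malgM_def !fgmulUU mul1m mulm1 mulrC.
Qed.

Lemma falg_scalerAr (k : K) (x y : falg) : k *: (x * y) = x * (k *: y).
Proof.
apply: lalg_scalerAr => z.
have E : k *: (1 : falg) = k%:MP by rewrite -[RHS]mulr1 mul_malgC.
by rewrite E; exact: malgC_comm.
Qed.

HB.instance Definition _ := GRing.Lalgebra_isAlgebra.Build K falg falg_scalerAr.

Section Eval.
Context (A : algType K) (g : G -> A).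
Let h (m : {fmonom G}) : A := \prod_(x <- (m : seq G)) g x.
Lemma h_morph : mmorphism h.
Proof. by split=> [m n|]; rewrite /h ?fmM ?fm1 ?big_cat ?big_nil. Qed.
HB.instance Definition _ := isMultiplicative.Build {fmonom G} A h h_morph.
Lemma falg_eval : exists phi : {lrmorphism falg -> A}, forall x, phi (fgen x) = g x.
Proof.
pose phi : falg -> A := mmap (in_alg A) h.
have phiM : multiplicative phi.
  apply: commr_mmap_is_multiplicative => u m m'.
  rewrite /GRing.comm /= mulr_algl -scalerAr mulr1 //.
have phiD : additive phi by exact: mmap_is_additive.
have phiZ : scalable phi.
  by move=> k u; rewrite /phi mmapZ /= mulr_algl.
pose M := GRing.isMonoidMorphism.Build falg A phi (phiM.2, phiM.1).
pose D := GRing.isZmodMorphism.Build falg A phi phiD.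
pose Z := GRing.isScalable.Build K falg A *:%R phi phiZ.
pose Phi : {lrmorphism falg -> A} := HB.pack phi M D Z.
by exists Phi => x; rewrite /= /phi mmapU /= scale1r mul1r /h fmU big_seq1.
Qed.
End Eval.
End FreeAlgebra.

(* Quotient of an algebra by the two-sided ideal generated by R. *)
Section TwoSidedQuotient.
Context (K : comNzRingType) (A : algType K) (R : set A).

Definition tideal : pred A := fun x =>
  `[< exists2 r : seq (A * A * A), {in r, forall t, R t.1.2} &
      x = \sum_(t <- r) t.1.1 * t.1.2 * t.2 >].

Lemma tideal0 : 0 \in tideal.
Proof. by apply/asboolP; exists [::]; rewrite ?big_nil. Qed.

Lemma tidealD : {in tideal &, forall x y, x + y \in tideal}.
Proof.
move=> x y /asboolP[r Hr ->] /asboolP[s Hs ->]; apply/asboolP.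
exists (r ++ s); last by rewrite big_cat.
by move=> t; rewrite mem_cat => /orP[/Hr|/Hs].
Qed.

Lemma tidealM a b x : x \in tideal -> a * x * b \in tideal.
Proof.
move=> /asboolP[r Hr ->]; apply/asboolP.
exists [seq (a * t.1.1, t.1.2, t.2 * b) | t <- r].
  by move=> _ /mapP[t tr ->] /=; exact: Hr.
rewrite big_map mulr_sumr mulr_suml; apply: eq_bigr => t _ /=.
by rewrite !mulrA.
Qed.

Lemma tideal_zmod : zmod_closed tideal.
Proof.
split=> [|x y Jx Jy]; first exact: tideal0.
by apply: tidealD => //; rewrite -mulN1r -[_ * y]mulr1; exact: tidealM.
Qed.
HB.instance Definition _ := GRing.isZmodClosed.Build A tideal tideal_zmod.

Lemma tideal_rel x : R x -> x \in tideal.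
Proof.
move=> Rx; apply/asboolP; exists [:: (1, x, 1)]; first by move=> t /[1!inE] /eqP->.
by rewrite big_seq1 /= mul1r mulr1.
Qed.

Context (tideal1 : 1 \notin tideal).
Let J : zmodClosed A := GRing.ZmodClosed.clone A tideal _.
Definition tquot of (1 \notin tideal) : Type := Quotient.quot J.
Local Notation Q := (tquot tideal1).
HB.instance Definition _ := GRing.Zmodule.on Q.
Definition tpi (x : A) : Q := (\pi_(Quotient.quot J) x)%qT.
Definition trepr (x : Q) : A := repr (x : Quotient.quot J).

Lemma treprK : cancel trepr tpi. Proof. exact: reprK. Qed.
Lemma tpi_eq x y : tpi x = tpi y <-> x - y \in tideal.
Proof. by rewrite /tpi Quotient.idealrBE; split => [->|/eqP]. Qed.
Lemma tpiD : {morph tpi : x y / x + y}. Proof. exact: Quotient.pi_add. Qed.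
Lemma tpi0 : tpi 0 = 0.
Proof. by apply: (addrI (tpi 0)); rewrite -tpiD !addr0. Qed.
Lemma tpiN : {morph tpi : x / - x}. Proof. exact: Quotient.pi_opp. Qed.

Definition tone : Q := tpi 1.
Definition tmul (x y : Q) : Q := tpi (trepr x * trepr y).
Definition tscale (k : K) (x : Q) : Q := tpi (k *: trepr x).

Lemma trepr_pi x : trepr (tpi x) - x \in tideal.
Proof. by apply/tpi_eq; rewrite treprK. Qed.

Lemma tmulE x y : tmul (tpi x) (tpi y) = tpi (x * y).
Proof.
apply/tpi_eq; set a := trepr _; set b := trepr _.
have -> : a * b - x * y = (a - x) * b + x * (b - y).
  by rewrite mulrBl mulrBr addrA subrK.
apply: rpredD; [rewrite -[_ * b]mul1r mulrA|rewrite -[x * _]mulr1];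
  exact/tidealM/trepr_pi.
Qed.

Lemma tscaleE k x : tscale k (tpi x) = tpi (k *: x).
Proof.
apply/tpi_eq; rewrite -scalerBr -[_ - _]mul1r scalerAl -[_ * _]mulr1.
exact/tidealM/trepr_pi.
Qed.

Let piP (P : Q -> Prop) : (forall a, P (tpi a)) -> forall x, P x.
Proof. by move=> H x; rewrite -[x]treprK. Qed.

Lemma tmulA : associative tmul.
Proof. by elim/piP=> a; elim/piP=> b; elim/piP=> c; rewrite !tmulE mulrA. Qed.
Lemma tmul1q : left_id tone tmul.
Proof. by elim/piP=> a; rewrite tmulE mul1r. Qed.
Lemma tmulq1 : right_id tone tmul.
Proof. by elim/piP=> a; rewrite tmulE mulr1. Qed.
Lemma tmulDl : left_distributive tmul +%R.
Proof.
by elim/piP=> a; elim/piP=> b; elim/piP=> c; rewrite !(tmulE, =^~ tpiD) mulrDl.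
Qed.
Lemma tmulDr : right_distributive tmul +%R.
Proof.
by elim/piP=> a; elim/piP=> b; elim/piP=> c; rewrite !(tmulE, =^~ tpiD) mulrDr.
Qed.
Lemma tone_neq0 : tone != 0.
Proof. by apply/eqP; rewrite -tpi0 => /tpi_eq; rewrite subr0; exact/negP. Qed.
HB.instance Definition _ := GRing.Zmodule_isNzRing.Build Q
  tmulA tmul1q tmulq1 tmulDl tmulDr tone_neq0.

Lemma tscaleA a b x : tscale a (tscale b x) = tscale (a * b) x.
Proof. by elim/piP: x => x; rewrite !tscaleE scalerA. Qed.
Lemma tscale1 : left_id 1 tscale.
Proof. by elim/piP=> x; rewrite !tscaleE scale1r. Qed.
Lemma tscaleDr : right_distributive tscale +%R.
Proof.
by move=> k; elim/piP=> a; elim/piP=> b; rewrite !(tscaleE, =^~ tpiD) scalerDr.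
Qed.
Lemma tscaleDl x : {morph tscale^~ x : a b / a + b}.
Proof. by elim/piP: x => x a b; rewrite !(tscaleE, =^~ tpiD) scalerDl. Qed.
HB.instance Definition _ := GRing.Zmodule_isLmodule.Build K Q
  tscaleA tscale1 tscaleDr tscaleDl.

Lemma tpiM : {morph tpi : x y / x * y}.
Proof. by move=> x y; exact/esym/tmulE. Qed.
Lemma tpi1 : tpi 1 = 1. Proof. by []. Qed.
Lemma tpiZ k : {morph tpi : x / k *: x}.
Proof. by move=> x; exact/esym/tscaleE. Qed.

Lemma tscaleAl (k : K) (x y : Q) : k *: (x * y) = (k *: x) * y.
Proof.
by elim/piP: x => x; elim/piP: y => y; rewrite -tpiM -!tpiZ -tpiM scalerAl.
Qed.
HB.instance Definition _ := GRing.Lmodule_isLalgebra.Build K Q tscaleAl.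
Lemma tscaleAr (k : K) (x y : Q) : k *: (x * y) = x * (k *: y).
Proof.
by elim/piP: x => x; elim/piP: y => y; rewrite -tpiM -!tpiZ -tpiM scalerAr.
Qed.
HB.instance Definition _ := GRing.Lalgebra_isAlgebra.Build K Q tscaleAr.
Lemma tquot_lift (B : algType K) (phi : {lrmorphism A -> B}) :
  (forall x, R x -> phi x = 0) ->
  exists psi : {lrmorphism Q -> B}, forall x, psi (tpi x) = phi x.
Proof.
move=> phi0; pose psi (x : Q) : B := phi (trepr x).
have psiE x : psi (tpi x) = phi x.
  apply/eqP; rewrite -subr_eq0 -rmorphB; apply/eqP.
  move: (trepr_pi x) => /asboolP[r Hr ->]; rewrite rmorph_sum /= big_seq big1 // => u /Hr Ru.
  by rewrite !rmorphM /= (phi0 _ Ru) mulr0 mul0r.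
have psiM : monoid_morphism psi.
  split; first by rewrite -tpi1 psiE rmorph1.
  by elim/piP=> x; elim/piP=> y; rewrite -tpiM !psiE rmorphM.
have psiD : zmod_morphism psi.
  by elim/piP=> x; elim/piP=> y; rewrite -tpiN -tpiD !psiE rmorphB.
have psiZ : scalable psi.
  by move=> k; elim/piP=> x; rewrite -tpiZ !psiE linearZ_LR.
pose M := GRing.isMonoidMorphism.Build Q B psi psiM.
pose D := GRing.isZmodMorphism.Build Q B psi psiD.
pose Z := GRing.isScalable.Build K Q B *:%R psi psiZ.
by exists (HB.pack_for {lrmorphism Q -> B} psi M D Z).
Qed.

Lemma tpi_lrmorph : exists p : {lrmorphism A -> Q}, p =1 tpi.
Proof.
have pM : monoid_morphism tpi by split; [exact: tpi1|exact: tpiM].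
have pD : zmod_morphism tpi by move=> x y; rewrite tpiD tpiN.
pose M := GRing.isMonoidMorphism.Build A Q tpi pM.
pose D := GRing.isZmodMorphism.Build A Q tpi pD.
pose Z := GRing.isScalable.Build K A Q *:%R tpi tpiZ.
by exists (HB.pack_for {lrmorphism A -> Q} tpi M D Z).
Qed.
End TwoSidedQuotient.

Section ConverseAlgebra.
Context (K : comNzRingType) (A : algType K).
HB.instance Definition _ := GRing.Zmodule_isLmodule.Build K A^c
  (@scalerA K A) (@scale1r K A) (@scalerDr K A) (fun v a b => @scalerDl K A v a b).
HB.instance Definition _ := GRing.Lmodule_isLalgebra.Build K A^c
  (fun k (x y : A) => @scalerAr K A k y x).
HB.instance Definition _ := GRing.Lalgebra_isAlgebra.Build K A^c
  (fun k (x y : A) => @scalerAl K A k y x).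
End ConverseAlgebra.

Definition zindep (V : zmodType) (J : eqType) (b : J -> V) : Prop :=
  forall (s : seq J) (c : J -> int), uniq s ->
    \sum_(j <- s) b j *~ c j = 0 -> {in s, forall j, c j = 0}.

Definition zspan (V : zmodType) (J : eqType) (b : J -> V) : Prop :=
  forall x : V, exists (s : seq J) (c : J -> int), x = \sum_(j <- s) b j *~ c j.

(* A symmetrizable generalized Cartan matrix [cmx], its symmetrizer [symd],   *)
(* and a realization of it: the weight lattice P is an arbitrary free abelian *)
(* group, and [coweight] is identified with Hom(P, Z) through [pairing].      *)
Record cartan_datum (I : choiceType) := CartanDatum {
  cmx : I -> I -> int;
  symd : I -> nat;
  weight : zmodType;
  coweight : zmodType;
  pairing : coweight -> weight -> int;
  root : I -> weight;
  coroot : I -> coweight;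
  cmx_diag : forall i, cmx i i = 2;
  cmx_offdiag : forall i j, i != j -> cmx i j <= 0;
  cmx_eq0 : forall i j, cmx i j = 0 -> cmx j i = 0;
  symd_gt0 : forall i, (0 < symd i)%N;
  symd_cmx : forall i j, (symd i)%:Z * cmx i j = (symd j)%:Z * cmx j i;
  weight_free : exists (J : choiceType) (b : J -> weight), zindep b /\ zspan b;
  pairingDl : forall x, {morph pairing^~ x : h h' / h + h'};
  pairingDr : forall h, {morph pairing h : x y / x + y};
  pairing_dual : forall phi : {additive weight -> int},
    exists! h, forall x, pairing h x = phi x;
  pairing_root : forall i j, pairing (coroot i) (root j) = cmx i j;
  root_indep : zindep root;
  coroot_indep : zindep coroot
}.

Definition Qq : fieldType := {fraction {poly rat}}.
Definition qv : Qq := tofrac ('X : {poly rat}).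

Definition qint (d n : nat) : Qq :=
  (qv ^+ (d * n) - qv ^- (d * n)) / (qv ^+ d - qv ^- d).
Definition qfact (d n : nat) : Qq := \prod_(1 <= m < n.+1) qint d m.
Definition dpow (A : algType Qq) (d : nat) (x : A) (n : nat) : A :=
  (qfact d n)^-1 *: x ^+ n.

Section Relations.
Context (I : choiceType) (D : cartan_datum I).

Definition qi (i : I) : Qq := qv ^+ symd D i.

Section InAlgebra.
Context (A : algType Qq).

Definition serre (x : I -> A) (i j : I) : A :=
  let n := `|1 - cmx D i j|%N in
  \sum_(k < n.+1)
    (-1) ^+ k *: (dpow (symd D i) (x i) (n - k) * x j * dpow (symd D i) (x i) k).

(* The defining relations of U_q(g), for families e_i, f_i, t h = q^h in A;   *)
(* K_i = q_i^{h_i} is t (d_i h_i), where d_i = symd i.                        *)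
Inductive uq_rel (e f : I -> A) (t : coweight D -> A) : A -> Prop :=
| rel_q0 : uq_rel e f t (t 0 - 1)
| rel_qD h h' : uq_rel e f t (t (h + h') - t h * t h')
| rel_qe h i : uq_rel e f t
    (t h * e i * t (- h) - qv ^ pairing h (root D i) *: e i)
| rel_qf h i : uq_rel e f t
    (t h * f i * t (- h) - qv ^ (- pairing h (root D i)) *: f i)
| rel_ef i j : uq_rel e f t
    (e i * f j - f j * e i -
      (if i == j then (qi i - (qi i)^-1)^-1 *:
         (t (coroot D i *+ symd D i) - t (- (coroot D i *+ symd D i)))
       else 0))
| rel_serre_e i j : i != j -> uq_rel e f t (serre e i j)
| rel_serre_f i j : i != j -> uq_rel e f t (serre f i j).
End InAlgebra.

Lemma serre_morph (A B : algType Qq) (phi : {lrmorphism A -> B}) g i j :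
  serre (phi \o g) i j = phi (serre g i j).
Proof.
rewrite /serre rmorph_sum /=; apply: eq_bigr => k _.
by rewrite linearZ_LR !rmorphM /= /dpow !linearZ_LR /= !rmorphXn.
Qed.

Lemma uq_rel_ef_morph (A B : algType Qq) (phi : {lrmorphism A -> B})
    (t : coweight D -> A) c (b : bool) x y :
  (if b then c *: (phi (t x) - phi (t y)) else 0) =
  phi (if b then c *: (t x - t y) else 0).
Proof. by case: b; rewrite ?raddf0 ?linearZ_LR ?rmorphB. Qed.

Lemma uq_rel_morph (A B : algType Qq) (phi : {lrmorphism A -> B}) e f t x :
  uq_rel e f t x -> uq_rel (phi \o e) (phi \o f) (phi \o t) (phi x).
Proof.
case=> [|h h'|h i|h i|i j|i j ij|i j ij].
- rewrite rmorphB rmorph1; exact: rel_q0 (phi \o t).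
- rewrite rmorphB rmorphM; exact: (rel_qD _ _ (phi \o t)).
- rewrite rmorphB !rmorphM /= [phi (_ *: _)]linearZ_LR; exact: (rel_qe (phi \o e) _ (phi \o t)).
- rewrite rmorphB !rmorphM /= [phi (_ *: _)]linearZ_LR; exact: (rel_qf _ (phi \o f) (phi \o t)).
- rewrite !rmorphB !rmorphM /= -uq_rel_ef_morph.
  exact: (rel_ef (phi \o e) (phi \o f) (phi \o t)).
- by rewrite -serre_morph; exact: rel_serre_e.
- by rewrite -serre_morph; exact: rel_serre_f.
Qed.

Lemma uq_rel_morph_inv (A B : algType Qq) (phi : {lrmorphism A -> B}) e f t y :
  uq_rel (phi \o e) (phi \o f) (phi \o t) y ->
  exists2 x, uq_rel e f t x & y = phi x.
Proof.
case=> [|h h'|h i|h i|i j|i j ij|i j ij].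
- by eexists; [exact: rel_q0|rewrite rmorphB rmorph1].
- by eexists; [exact: (rel_qD _ _ _ h h')|rewrite rmorphB rmorphM].
- by eexists; [exact: (rel_qe _ _ _ h i)|rewrite rmorphB !rmorphM /= [phi (_ *: _)]linearZ_LR].
- by eexists; [exact: (rel_qf _ _ _ h i)|rewrite rmorphB !rmorphM /= [phi (_ *: _)]linearZ_LR].
- by eexists; [exact: (rel_ef _ _ _ i j)
    |rewrite !rmorphB !rmorphM /= -uq_rel_ef_morph].
- by eexists; [exact: rel_serre_e ij|rewrite -serre_morph].
- by eexists; [exact: rel_serre_f ij|rewrite -serre_morph].
Qed.

(* The relations hold for e = f = 0 and q^h = 1: this is the counit. *)
Lemma uq_rel_counit (x : Qq^o) :
  uq_rel (fun=> 0) (fun=> 0) (fun=> 1) x -> x = 0.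
Proof.
have S0 i j : serre (fun=> 0 : Qq^o) i j = 0.
  by rewrite /serre big1 // => k _; rewrite mulr0 mul0r scaler0.
by case=> *; rewrite ?S0 ?mul1r ?mulr1 ?mulr0 ?mul0r ?scaler0 ?subrr ?scaler0
  ?if_same ?subr0.
Qed.

Lemma uq_rel_rev (A : algType Qq) (e f : I -> A) (t : coweight D -> A) x :
  uq_rel (e : I -> A^c) (f : I -> A^c) (fun h => t (- h)) x ->
  exists2 y, uq_rel e f t y & exists c : Qq, x = c *: (y : A).
Proof.
have C3 (a b c : A) : (a : A^c) * (b : A^c) * (c : A^c) = c * b * a :> A.
  exact: mulrA.
have dpow_rev d (a : A) n : dpow d (a : A^c) n = dpow d a n :> A.
  by rewrite /dpow revrX.
have Sr (g : I -> A) i j : serre (g : I -> A^c) i j =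
    ((-1) ^+ `|1 - cmx D i j|%N : Qq) *: serre g i j.
  rewrite /serre scaler_sumr (reindex_inj rev_ord_inj) /=.
  apply: eq_bigr => k _; rewrite subSS.
  have kn : (k <= `|1 - cmx D i j|)%N by rewrite -ltnS.
  rewrite subKn // scalerA -signr_odd oddB // signr_addb !signr_odd.
  congr (_ *: _); apply: etrans (C3 _ _ _) _.
  by rewrite !dpow_rev.
case=> [|h h'|h i|h i|i j|i j ij|i j ij].
- by exists (t 0 - 1); [constructor|exists 1; rewrite scale1r oppr0].
- exists (t (- h' + - h) - t (- h') * t (- h)); first by constructor.
  by exists 1; rewrite scale1r (opprD h) (addrC (- h)).
- exists (t h * e i * t (- h) - qv ^ pairing h (root D i) *: e i); first by constructor.
  by exists 1; rewrite scale1r opprK; congr (_ - _); exact: C3.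
- exists (t h * f i * t (- h) - qv ^ (- pairing h (root D i)) *: f i); first by constructor.
  by exists 1; rewrite scale1r opprK; congr (_ - _); exact: C3.
- exists (e i * f j - f j * e i -
      (if i == j then (qi i - (qi i)^-1)^-1 *:
         (t (coroot D i *+ symd D i) - t (- (coroot D i *+ symd D i)))
       else 0)); first by constructor.
  exists (-1); rewrite scaleN1r opprK !opprB.
  case: eqP => _; last by rewrite !subr0 add0r.
  by rewrite addrC -scalerN opprB.
- by exists (serre e i j); [constructor|eexists; exact: Sr].
- by exists (serre f i j); [constructor|eexists; exact: Sr].
Qed.

End Relations.

Section QuantumGroup.
Context (I : choiceType) (D : cartan_datum I).

Definition gens : choiceType := (I + I + coweight D)%type.
Definition free_alg : algType Qq := falg Qq gens.

Definition uq_defrel : set free_alg :=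
  @uq_rel I D free_alg (fun i => fgen Qq (inl (inl i) : gens))
    (fun i => fgen Qq (inl (inr i) : gens)) (fun h => fgen Qq (inr h : gens)).

Lemma uq_proper : 1 \notin tideal uq_defrel.
Proof.
have [phi phiE] := falg_eval (A := Qq^o)
  (fun x : gens => if x is inr _ then 1 else 0).
apply/asboolP => -[r Hr /(congr1 phi)].
rewrite rmorph1 rmorph_sum /= big_seq big1 => [/eqP|u /Hr Rt]; first by rewrite oner_eq0.
rewrite !rmorphM /= (_ : phi u.1.2 = 0) ?mulr0 ?mul0r //.
apply: uq_rel_counit; move/(uq_rel_morph phi): Rt.
by congr uq_rel; apply/funext => y /=; rewrite phiE.
Qed.

Definition uq : algType Qq := tquot uq_proper.
Definition uqpi (x : free_alg) : uq := tpi uq_proper x.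
Definition ue (i : I) : uq := uqpi (fgen Qq (inl (inl i) : gens)).
Definition uf (i : I) : uq := uqpi (fgen Qq (inl (inr i) : gens)).
Definition ut (h : coweight D) : uq := uqpi (fgen Qq (inr h : gens)).

Lemma uq_star_ex : exists s : {lrmorphism uq -> uq^c},
  [/\ forall i, s (ue i) = ue i, forall i, s (uf i) = uf i
    & forall h, s (ut h) = ut (- h)].
Proof.
have [p pE] := tpi_lrmorph uq_proper.
have [phi phiE] := falg_eval (A := uq^c) (fun x : gens =>
  match x with inl (inl i) => ue i | inl (inr i) => uf i | inr h => ut (- h) end).
have [x Rx|s sE] := tquot_lift uq_proper (phi := phi).
  have := uq_rel_morph phi Rx.
  have -> : phi \o (fun i => fgen Qq (inl (inl i) : gens)) = ue.
    by apply/funext => y /=; rewrite phiE.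
  have -> : phi \o (fun i => fgen Qq (inl (inr i) : gens)) = uf.
    by apply/funext => y /=; rewrite phiE.
  have -> : phi \o (fun h => fgen Qq (inr h : gens)) = (fun h => ut (- h)).
    by apply/funext => y /=; rewrite phiE.
  move=> /uq_rel_rev[y Ry [c ->]]; apply/eqP; rewrite (_ : y = 0) ?scaler0 //.
  have /uq_rel_morph_inv[z Rz ->] : uq_rel
     (p \o (fun i => fgen Qq (inl (inl i) : gens)))
     (p \o (fun i => fgen Qq (inl (inr i) : gens)))
     (p \o (fun h => fgen Qq (inr h : gens))) y.
    by move: Ry; congr uq_rel; apply/funext => u /=; rewrite pE.
  rewrite pE -tpi0; apply/tpi_eq; rewrite subr0; exact: tideal_rel.
by exists s; split => [i|i|h]; rewrite [LHS]sE phiE.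
Qed.

(* An antiautomorphism, as a morphism into the converse algebra. *)
Definition uq_star : {lrmorphism uq -> uq^c} := projT1 (cid uq_star_ex).
End QuantumGroup.

Section Crystal.
Context (I : choiceType) (D : cartan_datum I).
Local Notation U := (uq D).

(* U_q^-(g), the subalgebra generated by the f_i. *)
Definition uneg : set U := [set u | exists r : seq (Qq * seq I),
  u = \sum_(m <- r) m.1 *: \prod_(i <- m.2) uf D i].

(* [is_eprime i P Q] is Q = e'_i(P), where e'_i and e''_i are the operators   *)
(* on U_q^- given by                                                          *)
(*   [e_i, P] = (K_i e''_i(P) - K_i^-1 e'_i(P)) / (q_i - q_i^-1).             *)
Definition is_eprime (i : I) (P Q : U) : Prop :=
  uneg Q /\ exists2 Q', uneg Q' &
    ue D i * P - P * ue D i =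
    (qi D i - (qi D i)^-1)^-1 *:
      (ut (coroot D i *+ symd D i) * Q' - ut (- (coroot D i *+ symd D i)) * Q).

(* u = \sum_n f_i^(n) u_n with u_n in U_q^- and e'_i(u_n) = 0, s = (u_n). *)
Definition is_string (i : I) (u : U) (s : seq U) : Prop :=
  {in s, forall v, uneg v /\ is_eprime i v 0} /\
  u = \sum_(n < size s) dpow (symd D i) (uf D i) n * s`_n.

Definition etilde (i : I) (u : U) : U := xget 0 [set v | exists2 s,
  is_string i u s &
  v = \sum_(1 <= n < size s) dpow (symd D i) (uf D i) n.-1 * s`_n].

Definition ftilde (i : I) (u : U) : U := xget 0 [set v | exists2 s,
  is_string i u s &
  v = \sum_(n < size s) dpow (symd D i) (uf D i) n.+1 * s`_n].

Definition fmon (s : seq I) : U := foldr ftilde 1 s.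

(* The functions in Q(q) regular at q = 0. *)
Definition A0 : set Qq :=
  [set c | exists n d : {poly rat}, d.[0] != 0 /\ c = tofrac n / tofrac d].

Definition Linf : set U := [set u | exists2 r : seq (Qq * seq I),
  {in r, forall m, A0 m.1} & u = \sum_(m <- r) m.1 *: fmon m.2].

Definition modqL (u : U) : set U := [set u + qv *: l | l in Linf].

(* B(oo) is a set of classes in L(oo) / q L(oo), a class being a subset of U. *)
Definition Binf : Type := set_type (range (fun s => modqL (fmon s))).

Definition Binf1 : Binf := exist _ (modqL (fmon [::])) (mem_set (imageT _ [::])).

(* The elements of B(oo) that contain the image of the class b under g. *)
Definition induced (g : U -> U) (b : Binf) : set Binf :=
  [set b' | g @` val b `<=` val b'].

(* By Kashiwara's theorems, f~_i and * map B(oo) to B(oo) and e~_i maps it    *)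
(* to B(oo) U {0}; so, among the next three definitions, only [Be] ever takes *)
(* the default value of [xget], and then [None] stands for 0.                 *)
Definition Bf (i : I) (b : Binf) : Binf := xget b (induced (ftilde i) b).
Definition Be (i : I) (b : Binf) : option Binf :=
  xget None (Some @` induced (etilde i) b).
Definition Bstar (b : Binf) : Binf := xget b (induced (uq_star D) b).

Definition Beps (i : I) (b : Binf) : nat :=
  let nz n := isSome (iter n (obind (Be i)) (Some b)) in
  xget 0%N [set n | nz n /\ forall m, nz m -> (m <= n)%N].

Definition Bestar (i : I) (b : Binf) : option Binf :=
  omap Bstar (Be i (Bstar b)).
Definition Bepsstar (i : I) (b : Binf) : nat := Beps i (Bstar b).

Lemma A0N c : A0 c -> A0 (- c).
Proof. by move=> [n [d [d0 ->]]]; exists (- n), d; rewrite rmorphN mulNr. Qed.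

Lemma LinfB u v : Linf u -> Linf v -> Linf (u - v).
Proof.
move=> [r Hr ->] [s Hs ->]; exists (r ++ [seq (- m.1, m.2) | m <- s]).
  move=> m; rewrite mem_cat => /orP[/Hr //|/mapP[m' /Hs Hm' ->]] /=.
  exact: A0N.
rewrite big_cat big_map -sumrN; congr (_ + _).
by apply: eq_bigr => m _; rewrite scaleNr.
Qed.

Lemma Linf0 : Linf 0.
Proof. by exists [::]; rewrite ?big_nil. Qed.

Lemma modqL_id u : modqL u u.
Proof. by exists 0; rewrite ?scaler0 ?addr0 //; exact: Linf0. Qed.

Lemma modqL_eq u v : modqL u v -> modqL u = modqL v.
Proof.
move=> [l Ll <-]; apply/seteqP; split=> _ [m Lm <-].
  exists (m - l); first exact: LinfB.
  by rewrite scalerBr -addrA subrKC.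
exists (l + m); last by rewrite scalerDr addrA.
by rewrite -[m]opprK -[- m]sub0r; apply: LinfB => //; exact: LinfB Linf0 _.
Qed.

Lemma Bstar1 : Bstar Binf1 = Binf1.
Proof.
rewrite /Bstar; case: xgetP => // b _ H.
have : val b 1 by apply: H; exists 1; [exact: modqL_id|exact: (rmorph1 (uq_star D))].
move: (set_mem (valP b)) => [s _ bE]; rewrite -bE => /modqL_eq E.
by apply: val_inj; rewrite -[LHS]bE E.
Qed.

Definition Bhat : Type :=
  set_type [set b : int -> Binf | finite_set [set k | b k <> Binf1]].

Implicit Types (b : Bhat) (i : I) (k t : int).

Definition Beps_hat i k b : int :=
  (Beps i (val b k))%:Z - (Bepsstar i (val b (k + 1)))%:Z.

(* When [Beps_hat i k b] < 0, eps*_i(b_{k+1}) > 0, so that [Bestar] is [Some]. *)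
Definition Fhat_fun i k b : int -> Binf := fun l =>
  if 0 <= Beps_hat i k b
  then if l == k then Bf i (val b k) else val b l
  else if l == k + 1 then odflt (val b (k + 1)) (Bestar i (val b (k + 1)))
       else val b l.

Lemma Fhat_subproof i k b : finite_set [set l | Fhat_fun i k b l <> Binf1].
Proof.
have bfin := set_mem (valP b).
apply: (@sub_finite_set _ _ ([set l | val b l <> Binf1] `|` [set k; k + 1])).
  move=> l /=; rewrite /Fhat_fun.
  by case: ifP => _; case: eqP => [-> _|_]; [right; left|left|right; right|left].
by rewrite finite_setU; split => //; exact: finite_set2.
Qed.
Definition Fhat i k b : Bhat := exist _ (Fhat_fun i k b) (mem_set (Fhat_subproof i k b)).

Lemma star_hat_subproof b : finite_set [set k | Bstar (val b (- k)) <> Binf1].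
Proof.
have bfin := set_mem (valP b).
apply: sub_finite_set (finite_image -%R bfin) => k /= H.
exists (- k); last by rewrite opprK.
by move=> E; apply: H; rewrite E Bstar1.
Qed.
Definition star_hat b : Bhat :=
  exist _ (fun k => Bstar (val b (- k))) (mem_set (star_hat_subproof b)).

Definition Fhat_star i k b : Bhat := star_hat (Fhat i (- k) (star_hat b)).

Lemma Dshift_subproof t b : finite_set [set k | val b (k - t) <> Binf1].
Proof.
have bfin := set_mem (valP b).
apply: sub_finite_set (finite_image (+%R t) bfin) => k /= H.
by exists (k - t) => //; rewrite subrKC.
Qed.
Definition Dshift t b : Bhat :=
  exist _ (fun k => val b (k - t)) (mem_set (Dshift_subproof t b)).
End Crystal.

(* Main.v *)
Require Import Defs.
From HB Require Import structures.
From mathcomp Require Import all_boot all_order all_algebra.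
From mathcomp Require boolp.
Set Implicit Arguments.
Unset Strict Implicit.
Unset Printing Implicit Defensive.
Import GRing.Theory.
Local Open Scope ring_scope.

(** The rule defining [Fhat i k] depends on the components at positions [k] and
    [k + 1] but not on the value of [k], so a translation of all positions
    carries it to [Fhat i (k + t)]: this is [Dshift_Fhat].  The star involution
    reflects positions through [0], so it intertwines the shift by [t] with the
    shift by [- t] ([Dshift_star_hat]).  Since [Fhat_star i k] is the conjugate
    of [Fhat i (- k)] by the star involution, its equivariance under the shift
    by [t] is the equivariance of [Fhat] under the shift by [- t]. *)

Section Shift.
Context (I : choiceType) (D : cartan_datum I).
Implicit Types (i : I) (k t : int) (b : Bhat D).

Lemma Bhat_ext b b' : (forall l, val b l = val b' l) -> b = b'.
Proof. by move=> bb'; apply: val_inj; apply: boolp.funext. Qed.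

Lemma DshiftK t : cancel (@Dshift I D t) (@Dshift I D (- t)).
Proof. by move=> b; apply: Bhat_ext => l /=; rewrite opprK addrK. Qed.

Lemma Dshift_bij t : bijective (@Dshift I D t).
Proof.
exists (@Dshift I D (- t)); first exact: DshiftK.
by move=> b; rewrite -{1}[t]opprK DshiftK.
Qed.

Lemma Beps_hat_Dshift i k t b :
  Beps_hat i (k + t) (Dshift t b) = Beps_hat i k b.
Proof. by rewrite /Beps_hat /= (addrAC k t 1) !addrK. Qed.

Lemma Dshift_Fhat i k t b :
  Dshift t (Fhat i k b) = Fhat i (k + t) (Dshift t b).
Proof.
apply: Bhat_ext => l /=; rewrite /Fhat_fun Beps_hat_Dshift /=.
by rewrite (addrAC k t 1) !addrK !subr_eq.
Qed.

Lemma Dshift_star_hat t b :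
  Dshift t (star_hat b) = star_hat (Dshift (- t) b).
Proof. by apply: Bhat_ext => l /=; rewrite opprB opprK addrC. Qed.

Lemma Dshift_Fhat_star i k t b :
  Dshift t (Fhat_star i k b) = Fhat_star i (k + t) (Dshift t b).
Proof.
rewrite /Fhat_star Dshift_star_hat Dshift_Fhat Dshift_star_hat.
by rewrite opprK opprD.
Qed.

End Shift.

Theorem lemma4p3 (I : choiceType) (D : cartan_datum I) (t : int) :
  bijective (Dshift t : Bhat D -> Bhat D) /\
  forall (i : I) (k : int) (b : Bhat D),
    Dshift t (Fhat i k b) = Fhat i (k + t) (Dshift t b) /\
    Dshift t (Fhat_star i k b) = Fhat_star i (k + t) (Dshift t b).
Proof.
split; first exact: Dshift_bij.
by move=> i k b; split; [exact: Dshift_Fhat | exact: Dshift_Fhat_star].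
Qed.
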